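(* Let $M \in \{0,1\}^{n \times n}$ be a binary matrix of twin-width $d$. Then both the row-Hamming-coherence and the column-Hamming-coherence of $M$ satisfy $\mathscr{H}^r(M), \mathscr{H}^c(M) \in 2^{2^{\mathcal{O}(d)}} \cdot n \log n$.
   Context: The Hamming distance of $u,v\in\{0,1\}^n$ is $d(u,v)=\sum_{i=1}^n|u_i-v_i|$. Let $r^{(1)},\dots,r^{(n)}$ be the rows of $M$. For a permutation $\pi$ of $[n]$, the row-Hamming-sum is $\mathscr{H}^r_\pi(M)=\sum_{i=1}^{n-1} d(r^{(\pi(i))},r^{(\pi(i+1))})$, and the row-Hamming-coherence is $\mathscr{H}^r(M)=\min_\pi \mathscr{H}^r_\pi(M)$. The column-Hamming-sum and column-Hamming-coherence $\mathscr{H}^c(M)$ are defined analogously using the columns. Twin-width. A division of an $n\times n$ matrix $M$ is a pair $(\mathcal{R},\mathscr{C})$ of partitions of $[n]$ into contiguous non-empty intervals; the cell $(i,j)$ is the submatrix with rows in the $i$-th interval of $\mathcal{R}$ and columns in the $j$-th interval of $\mathscr{C}$; a cell is constant if all its entries are equal. A row (resp. column) of the division is the set of cells sharing a given interval of $\mathcal{R}$ (resp. $\mathscr{C}$). A merge sequence is a sequence of divisions $(\mathcal{R}_{2n-1},\mathscr{C}_{2n-1}),\dots,(\mathcal{R}_1,\mathscr{C}_1)$ starting from the singleton partitions, ending with $\mathcal{R}_1=\mathscr{C}_1=\{[n]\}$, each obtained from the previous by merging two adjacent intervals of either the row or the column partition. It is $d$-wide if in every division every row and every column contains at most $d$ non-constant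 cells. $M$ is $d$-twin-ordered if it admits a $d$-wide merge sequence; the twin-width of $M$ is the least $d$ such that some permutation of the rows and of the columns of $M$ is $d$-twin-ordered. *)

(* Defs.v *)
From mathcomp Require Import all_boot all_order all_algebra all_fingroup.
Set Implicit Arguments. Unset Strict Implicit. Unset Printing Implicit Defensive.

Definition row_dist n (M : 'M[bool]_n) (i i' : 'I_n) : nat :=
  \sum_(j < n) (M i j != M i' j).

Definition consec_sum (T : Type) (f : T -> T -> nat) (s : seq T) : nat :=
  \sum_(xy <- zip s (behead s)) f xy.1 xy.2.

Definition row_hsum n (M : 'M[bool]_n) (pi : 'S_n) : nat :=
  consec_sum (row_dist M) [seq pi i | i <- enum 'I_n].

Definition row_coherence n (M : 'M[bool]_n) : nat :=
  \big[minn/row_hsum M 1%g]_(pi : 'S_n) row_hsum M pi.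

Definition col_coherence n (M : 'M[bool]_n) : nat := row_coherence M^T.

(* A partition of [n] into contiguous non-empty intervals is encoded by the
   labelling p : 'I_n -> nat sending each index to the number (0-based) of
   the interval containing it. *)

(* merging the two adjacent intervals number k and k+1 (both non-empty) *)
Definition merge_step n (p p' : 'I_n -> nat) : Prop :=
  exists k : nat, (exists x, p x = k.+1) /\
    forall x, p' x = (if k < p x then (p x).-1 else p x).

Definition division n := (('I_n -> nat) * ('I_n -> nat))%type.

Definition nonconst_cell n (M : 'M[bool]_n) (D : division n) (a b : nat) : bool :=
  [exists i : 'I_n, exists j : 'I_n, exists i' : 'I_n, exists j' : 'I_n,
     [&& D.1 i == a, D.2 j == b, D.1 i' == a, D.2 j' == b & M i j != M i' j']].

(* every row and every column of the division has at most d non-constant cells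
   (interval labels are < n) *)
Definition d_wide n (M : 'M[bool]_n) (D : division n) (d : nat) : Prop :=
  (forall a : 'I_n, #|[set b : 'I_n | nonconst_cell M D a b]| <= d) /\
  (forall b : 'I_n, #|[set a : 'I_n | nonconst_cell M D a b]| <= d).

(* S 0, S 1, ..., S (2n-2) is a merge sequence (the paper's
   (R_{2n-1},C_{2n-1}), ..., (R_1,C_1)) *)
Definition merge_sequence n (S : nat -> division n) : Prop :=
  (forall x : 'I_n, (S 0).1 x = x /\ (S 0).2 x = x) /\
  (forall x : 'I_n, (S (2 * n - 2)).1 x = 0 /\ (S (2 * n - 2)).2 x = 0) /\
  (forall t, t < 2 * n - 2 ->
     (merge_step (S t).1 (S t.+1).1 /\ (forall x, (S t.+1).2 x = (S t).2 x)) \/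
     (merge_step (S t).2 (S t.+1).2 /\ (forall x, (S t.+1).1 x = (S t).1 x))).

Definition twin_ordered n (M : 'M[bool]_n) (d : nat) : Prop :=
  exists S : nat -> division n, merge_sequence S /\
    forall t, t <= 2 * n - 2 -> d_wide M (S t) d.

Definition twin_width_le n (M : 'M[bool]_n) (d : nat) : Prop :=
  exists (sr sc : 'S_n), twin_ordered (\matrix_(i, j) M (sr i) (sc j)) d.

Definition twin_width n (M : 'M[bool]_n) (d : nat) : Prop :=
  twin_width_le M d /\ forall d', twin_width_le M d' -> d <= d'.

(* Main.v *)
(* Any [m >= 2] rows of a matrix of twin-width [d] contain two at Hamming
   distance at most [D n / m], where [D] depends only on [d]. Removing one row of
   such a pair, ordering the remaining rows, and reinserting the row next to its
   partner costs at most [2 D n / m] by the triangle inequality, so the total cost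
   is at most a harmonic sum [2 D n (1/2 + ... + 1/n)].

   For the packing bound, let [X] be pairwise far rows. Follow the merge sequence
   up to the first column part [Q] containing many columns. Just before, the rows
   of [X] inside one row part differ only on at most [d] small column parts, so
   there are few of them; and [Q] is non-constant on at most [d] row parts.
   Deleting these few rows of [X], all others are constant on [Q], which can
   be replaced by one representative column. Iterate, also discarding one of two
   representatives as soon as they share a column part. *)
Require Import Defs.
From mathcomp Require Import all_boot all_order all_algebra all_fingroup.
From mathcomp Require Import zify.
Set Implicit Arguments. Unset Strict Implicit. Unset Printing Implicit Defensive.

(* [L] are the columns not yet absorbed, [B] the representative columns. *)
Definition separated n (M : 'M[bool]_n) (X L B : {set 'I_n}) (s : nat) :=
  forall x x', x \in X -> x' \in X -> x != x' ->
    {in B, forall j, M x j = M x' j} -> s < #|[set j in L | M x j != M x' j]|.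

(** Its failure marks the event that ends a round of the iteration: a column part became heavy in
    [L], or two representatives met. *)
Definition fine_labelling n (p : 'I_n -> nat) (L B : {set 'I_n}) (e : nat) :=
  [forall j0, #|[set j in L | p j == p j0]| <= e] &&
  [forall j in B, forall j' in B, (p j == p j') ==> (j == j')].

Lemma eq_fine_labelling n (p p' : 'I_n -> nat) L B e :
  p =1 p' -> fine_labelling p L B e = fine_labelling p' L B e.
Proof.
move=> pp'; congr (_ && _).
  apply: eq_forallb => j0; congr (_ <= _); apply: eq_card => j.
  by rewrite !inE !pp'.
apply: eq_forallb => j; congr (_ ==> _); apply: eq_forallb => j'.
by rewrite !pp'.
Qed.

Lemma fine_labelling_or n (p : 'I_n -> nat) (L B : {set 'I_n}) e :
  ~~ fine_labelling p L B e ->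
  (exists j0, e < #|[set j in L | p j == p j0]|) \/
  (exists j j', [/\ j \in B, j' \in B, p j = p j' & j != j']).
Proof.
rewrite negb_and => /orP[/forallPn[j0]|/forall_inPn[j jB /forall_inPn[j' j'B]]].
  by rewrite -ltnNge => h; left; exists j0.
by rewrite negb_imply => /andP[/eqP pp jj]; right; exists j, j'.
Qed.

(** Merges only lower labels. As [d_wide] counts labels in ['I_n], this lets every occurring label
    be counted there. *)
Lemma merge_sequence_label_lt n (S : nat -> division n) t (x : 'I_n) :
  merge_sequence S -> t <= 2 * n - 2 -> (S t).1 x < n /\ (S t).2 x < n.
Proof.
move=> [S0 [_ Sstep]]; elim: t => [|t IH] ht.
  by have [-> ->] := S0 x; rewrite ltn_ord.
have [h1 h2] := IH (ltnW ht).
case: (Sstep t ht) => -[[k [_ e1]] e2]; rewrite e1 e2; split=> //.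
  by case: ifP => _ //; apply: leq_ltn_trans h1; apply: leq_pred.
by case: ifP => _ //; apply: leq_ltn_trans h2; apply: leq_pred.
Qed.

Lemma nonconst_cellP n (M : 'M[bool]_n) (D : division n) (i i' j j' : 'I_n) :
  D.1 i = D.1 i' -> D.2 j = D.2 j' -> M i j != M i' j' ->
  nonconst_cell M D (D.1 i) (D.2 j).
Proof.
move=> hi hj hM; apply/existsP; exists i; apply/existsP; exists j.
by apply/existsP; exists i'; apply/existsP; exists j'; rewrite !eqxx hi hj !eqxx.
Qed.

Lemma switch_time (P : pred nat) T :
  P 0 -> ~~ P T -> exists2 t, t < T & P t && ~~ P t.+1.
Proof.
move=> P0; elim: T => [|T IH] PT; first by rewrite P0 in PT.
have [PT'|/IH[t tT Pt]] := boolP (P T); first by exists T; rewrite ?PT'.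
by exists t => //; apply: ltnW.
Qed.

Lemma leq_card_cover (I T : finType) (R : {set I}) (F : I -> {set T})
    (Z : {set T}) k :
  {in Z, forall x, exists2 b, b \in R & x \in F b} ->
  {in R, forall b, #|F b| <= k} -> #|Z| <= #|R| * k.
Proof.
move=> cov leF; apply: (@leq_trans #|\bigcup_(b in R) F b|).
  by apply/subset_leq_card/subsetP => x /cov[b bR xb]; apply/bigcupP; exists b.
rewrite -sum_nat_const; apply: leq_trans (leq_sum _ leF).
by elim/big_rec2: _ => [|b m A _ leA]; rewrite ?cards0 // cardsU; lia.
Qed.

(** * Packing bound for separated rows along a merge sequence *)

Section Packing.

Variables (n d e : nat) (M : 'M[bool]_n) (S : nat -> division n).
Hypothesis Smerge : merge_sequence S.
Hypothesis Swide : forall t, t <= 2 * n - 2 -> d_wide M (S t) d.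

(** Rows in part [a] can differ only on the at most [d] column parts in [R]. Each part holds at most
    one representative, so the subset of [R] where a row's representative entry is 1 determines the
    row on [B]. Two rows with the same subset would then differ on at most [d * e] columns of [L],
    against separation. *)
Lemma card_separated_part t (X L B : {set 'I_n}) (a : 'I_n) :
  t <= 2 * n - 2 -> separated M X L B (d * e) ->
  fine_labelling (S t).2 L B e ->
  #|[set x in X | (S t).1 x == a]| <= 2 ^ d.
Proof.
move=> ht sepX /andP[/forallP lightL /forall_inP injB].
have [wide _] := Swide ht.
set R := [set b : 'I_n | nonconst_cell M (S t) a b].
have cardR : #|R| <= d by apply: wide.
have inR x x' j : (S t).1 x == a -> (S t).1 x' == a -> M x j != M x' j ->
    exists2 b : 'I_n, b \in R & (S t).2 j = b.
  move=> /eqP hx /eqP hx' hM.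
  have [_ lt2] := merge_sequence_label_lt j Smerge ht.
  exists (Ordinal lt2) => //; rewrite inE /= -hx.
  by apply: nonconst_cellP hM; rewrite // hx hx'.
set Y := [set x in X | _].
pose f x := [set b in R | [exists j in B, ((S t).2 j == b) && M x j]].
have fP x x' : (S t).1 x == a -> (S t).1 x' == a -> f x = f x' ->
    {in B, forall j, M x j -> M x' j}.
  move=> hx hx' eqf j jB Mxj; apply/negPn/negP => Mx'j.
  have [|b bR eb] := inR x x' j hx hx'; first by rewrite Mxj (negbTE Mx'j).
  have: b \in f x.
    by rewrite inE bR; apply/exists_inP; exists j; rewrite // eb eqxx.
  rewrite eqf inE bR => /exists_inP[j' j'B /andP[/eqP eb' Mx'j']].
  have /forall_inP/(_ _ j'B)/implyP := injB _ jB.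
  by rewrite eb eb' eqxx => /(_ isT)/eqP jj'; rewrite jj' Mx'j' in Mx'j.
have finj : {in Y &, injective f}.
  move=> x x'; rewrite !inE => /andP[xX hx] /andP[x'X hx'] eqf.
  apply/eqP/negPn/negP => xx'.
  have agree : {in B, forall j, M x j = M x' j}.
    by move=> j jB; apply/idP/idP; apply: fP jB.
  have := sepX x x' xX x'X xx' agree; rewrite ltnNge => /negP; apply.
  pose F (b : 'I_n) := [set j in L | (S t).2 j == b].
  apply: leq_trans (leq_mul cardR (leqnn e)); apply: (@leq_card_cover _ _ _ F).
    move=> j; rewrite inE => /andP[jL hM].
    have [b bR eb] := inR x x' j hx hx' hM; exists b => //.
    by rewrite inE jL eb /=.
  move=> b _; have [->|[j0]] := set_0Vmem (F b); first by rewrite cards0.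
  by rewrite inE => /andP[_ /eqP eb]; rewrite /F -eb; apply: lightL.
have fpow : f @: Y \subset powerset R.
  apply/subsetP => _ /imsetP[x _ ->]; rewrite powersetE.
  by apply/subsetP => b; rewrite inE => /andP[].
rewrite -(card_in_imset finj); apply: leq_trans (subset_leq_card fpow) _.
by rewrite card_powerset leq_exp2l.
Qed.

(** A row that is not constant on column part [b] lies in one of at most [d] row parts, by width at
    [t.+1]; each of these has few rows of [X], by fineness at [t]. The two times share their row
    parts. *)
Lemma card_split_rows t (X L B Z : {set 'I_n}) (b : 'I_n) :
  t < 2 * n - 2 -> separated M X L B (d * e) ->
  fine_labelling (S t).2 L B e -> (S t.+1).1 =1 (S t).1 -> Z \subset X ->
  {in Z, forall x, exists j j', [/\ (S t.+1).2 j = b, (S t.+1).2 j' = b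
                                  & M x j != M x j']} ->
  #|Z| <= d * 2 ^ d.
Proof.
move=> ht sepX fine eqrow /subsetP ZX splitZ.
have [_ /(_ b) wide] := Swide ht.
apply: leq_trans (leq_mul wide (leqnn _)).
apply: (@leq_card_cover _ _ _ (fun a : 'I_n => [set x in X | (S t).1 x == a])).
  move=> x xZ; have [j [j' [hj hj' hM]]] := splitZ x xZ.
  have [lt1 _] := merge_sequence_label_lt x Smerge ht.
  exists (Ordinal lt1); last by rewrite inE ZX //= eqrow.
  by rewrite inE /= -hj; apply: nonconst_cellP hM; rewrite // hj hj'.
by move=> a _; apply: card_separated_part (ltnW ht) sepX fine.
Qed.

(** One round. In the potential [2 * (#|L| %/ e.+1) + #|B|], absorbing a heavy part lowers the
    quotient by at least 1 and adds at most one representative; a collision removes one. *)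
Lemma separated_step (X L B : {set 'I_n}) :
  0 < e -> separated M X L B (d * e) ->
  #|X| <= 2 ^ d \/
  exists X' L' B' : {set 'I_n},
    [/\ separated M X' L' B' (d * e), #|X| <= d * 2 ^ d + #|X'| &
        2 * (#|L'| %/ e.+1) + #|B'| < 2 * (#|L| %/ e.+1) + #|B|].
Proof.
move=> e_gt0 sepX; have [S0 [Send Sstep]] := Smerge.
have fine0 : fine_labelling (S 0).2 L B e.
  apply/andP; split.
    apply/forallP => j0; apply: leq_trans e_gt0; rewrite -(cards1 j0).
    apply/subset_leq_card/subsetP => j; rewrite !inE => /andP[_].
    by have [_ ->] := S0 j; have [_ ->] := S0 j0.
  apply/forall_inP => j _; apply/forall_inP => j' _; apply/implyP.
  by have [_ ->] := S0 j; have [_ ->] := S0 j'.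
(* If no event ever occurs, the final division has all of [X] in its single row part. *)
have [fineT|] := boolP (fine_labelling (S (2 * n - 2)).2 L B e).
  left; have [->|[x0 _]] := set_0Vmem X; first by rewrite cards0.
  have n_gt0 : 0 < n by apply: leq_ltn_trans (ltn_ord x0).
  apply: leq_trans (card_separated_part (Ordinal n_gt0) (leqnn _) sepX fineT).
  apply/subset_leq_card/subsetP => x xX; rewrite inE xX /=.
  by have [-> _] := Send x.
move=> /(@switch_time (fun t => fine_labelling (S t).2 L B e) _ fine0).
move=> [t ht /andP[fine nfine]]; right.
(* A row merge leaves the column labelling, hence fineness, unchanged, so the step at [t] merges
   columns. *)
have eqrow : (S t.+1).1 =1 (S t).1.
  case: (Sstep t ht) => -[_ eqS]; last exact: eqS.
  by rewrite (eq_fine_labelling _ _ _ eqS) fine in nfine.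
have lab j : (S t.+1).2 j < n by case: (merge_sequence_label_lt j Smerge ht).
have splitX (Z : {set 'I_n}) (j0 : 'I_n) :
    {in Z, forall x, exists j j', [/\ (S t.+1).2 j = (S t.+1).2 j0,
        (S t.+1).2 j' = (S t.+1).2 j0 & M x j != M x j']} ->
    #|X| <= d * 2 ^ d + #|X :\: Z|.
  move=> hZ; rewrite -(cardsID Z X) leq_add2r.
  apply: (card_split_rows (b := Ordinal (lab j0)) ht sepX fine eqrow).
    exact: subsetIl.
  by move=> x; rewrite inE => /andP[_ /hZ].
case/fine_labelling_or: nfine => [[j0 heavy]|[j0 [j1 [B0 B1 e01 ne01]]]].
  set Q := [set j in L | _] in heavy.
  have [Q0|[q qQ]] := set_0Vmem Q; first by rewrite Q0 cards0 in heavy.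
  (* Rows outside [Z] are constant on [Q]: agreement at [q] forces agreement on all of [Q], so
     dropping [Q] from [L] loses no differing column. *)
  pose Z := [set x | [exists j in Q, exists j' in Q, M x j != M x j']].
  exists (X :\: Z), (L :\: Q), (q |: B); split.
  - move=> x x'; rewrite !inE => /andP[xZ xX] /andP[x'Z x'X] xx' agree.
    have constQ y : ~~ [exists j in Q, exists j' in Q, M y j != M y j'] ->
        {in Q, forall j, M y j = M y q}.
      move=> /exists_inPn h j jQ; have /exists_inPn/(_ q qQ) := h j jQ.
      by rewrite negbK => /eqP.
    have agreeQ : {in Q, forall j, M x j = M x' j}.
      move=> j jQ; rewrite (constQ x xZ j jQ) (constQ x' x'Z j jQ).
      by apply: agree; rewrite setU11.
    have agreeB : {in B, forall j, M x j = M x' j}.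
      by move=> j jB; apply: agree; rewrite setU1r.
    apply: leq_trans (sepX x x' xX x'X xx' agreeB) _.
    apply/subset_leq_card/subsetP => j; rewrite [in X in X -> _]inE.
    move=> /andP[jL jM]; rewrite inE jM andbT inE jL andbT.
    by apply: contra jM => /agreeQ ->.
  - apply: (splitX Z j0) => x; rewrite inE => /exists_inP[j jQ].
    move=> /exists_inP[j' j'Q hM]; exists j, j'; split=> //.
      by move: jQ; rewrite inE => /andP[_ /eqP].
    by move: j'Q; rewrite inE => /andP[_ /eqP].
  - have QL : Q \subset L by apply/subsetP => j; rewrite inE => /andP[].
    have cQ := cardsID Q L; rewrite (setIidPr QL) in cQ.
    have : (#|L :\: Q| + e.+1) %/ e.+1 <= #|L| %/ e.+1 by apply: leq_div2r; lia.
    rewrite divnDr // divnn /=.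
    by have := cardsU1 q B; case: (q \notin B) => /=; lia.
(* On rows outside [Z], column [j1] duplicates [j0], so [j0] alone can represent both. *)
pose Z := [set x | M x j0 != M x j1].
exists (X :\: Z), L, (B :\ j1); split.
- move=> x x'; rewrite !inE !negbK => /andP[/eqP x01 xX] /andP[/eqP x'01 x'X].
  move=> xx' agree; apply: sepX => // j jB.
  have agree0 : M x j0 = M x' j0 by apply: agree; rewrite !inE ne01.
  have [->|jj1] := eqVneq j j1; first by rewrite -x01 -x'01.
  by apply: agree; rewrite !inE jj1.
- by apply: (splitX Z j0) => x; rewrite inE => hM; exists j0, j1.
- by rewrite [in X in _ < X](cardsD1 j1 B) B1; lia.
Qed.

(** Induction on the potential: each round deletes at most [d * 2 ^ d] rows, and the last one leaves
    at most [2 ^ d]. *)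
Lemma card_separated N (X L B : {set 'I_n}) :
  0 < e -> 2 * (#|L| %/ e.+1) + #|B| <= N -> separated M X L B (d * e) ->
  #|X| <= d.+1 * 2 ^ d * N.+1.
Proof.
move=> e_gt0; elim: N X L B => [|N IH] X L B hN sepX.
  have [h|[X' [L' [B' [_ _ hN']]]]] := separated_step e_gt0 sepX.
    by apply: leq_trans h _; rewrite muln1 leq_pmull.
  by have := leq_trans hN' hN.
have [h|[X' [L' [B' [sepX' hX hN']]]]] := separated_step e_gt0 sepX.
  by apply: leq_trans h _; rewrite mulnAC leq_pmull.
have /IH /(_ sepX') hX' := leq_trans hN' hN.
apply: leq_trans hX _; rewrite mulnS; apply: leq_add hX'.
by rewrite leq_mul2r leqnSn orbT.
Qed.

End Packing.

(** * Two close rows in every set of rows *)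

Lemma row_dist_card n (M : 'M[bool]_n) i i' :
  row_dist M i i' = #|[set j | M i j != M i' j]|.
Proof.
rewrite /row_dist -sum1dep_card [RHS]big_mkcond.
by apply: eq_bigr => j _; case: (_ != _).
Qed.

Lemma twin_ordered_close_rows n d (M : 'M[bool]_n) (X : {set 'I_n}) :
  twin_ordered M d -> 1 < #|X| ->
  exists x x', [/\ x \in X, x' \in X, x != x' &
    row_dist M x x' * #|X| <= 4 * d.+1 ^ 2 * 2 ^ d * n].
Proof.
move=> [S [Smerge Swide]] X_gt1.
(* With [K = d.+1 * 2 ^ d], this [e] is about [4 * K * n / #|X|]: small enough that far rows are
   [d * e]-separated, large enough that the packing bound is about [K + #|X| / 2]. *)
pose e := (4 * (d.+1 * 2 ^ d) * n) %/ #|X|.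
have Xn : #|X| <= n by rewrite -[n in _ <= n]card_ord max_card.
have K_gt0 : 0 < 2 ^ d by rewrite expn_gt0.
have e_gt0 : 0 < e by rewrite divn_gt0; [nia | lia].
have heX : e * #|X| <= 4 * (d.+1 * 2 ^ d) * n by apply: leq_divM.
have [/existsP[x /existsP[x' /and4P[xX x'X xx' hd]]]|far] := boolP
    [exists x, exists x', [&& x \in X, x' \in X, x != x' &
       row_dist M x x' * #|X| <= 4 * d.+1 ^ 2 * 2 ^ d * n]].
  by exists x, x'.
have {}far x x' : x \in X -> x' \in X -> x != x' ->
    4 * d.+1 ^ 2 * 2 ^ d * n < row_dist M x x' * #|X|.
  move=> xX x'X xx'; move/existsPn/(_ x)/existsPn/(_ x'): far.
  by rewrite xX x'X xx' /= -ltnNge.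
have sepX : separated M X setT set0 (d * e).
  move=> x x' xX x'X xx' _; have := far x x' xX x'X xx'.
  rewrite row_dist_card.
  rewrite (_ : [set j in _ | _] = [set j | M x j != M x' j]); last first.
    by apply/setP => j; rewrite !inE.
  move=> hfar; rewrite -(ltn_pmul2r (ltnW X_gt1)); apply: leq_ltn_trans hfar.
  rewrite -mulnA; apply: leq_trans (leq_mul (leqnSn d) heX) _.
  by rewrite -mulnn; lia.
have := card_separated Smerge Swide e_gt0 (leqnn _) sepX.
rewrite cards0 addn0 cardsT card_ord.
have /card_gt1P[x [x' [xX x'X xx']]] := X_gt1.
have hn : row_dist M x x' <= n.
  by rewrite row_dist_card -[n in _ <= n]card_ord max_card.
have := far x x' xX x'X xx'.
have := ltn_ceil (4 * (d.+1 * 2 ^ d) * n) (ltnW X_gt1); rewrite -/e.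
have := leq_divM n e.+1.
move: (n %/ e.+1) => q hq; rewrite expnS expn1.
move: (2 ^ d) K_gt0 => D D_gt0 hceil hfar.
rewrite -!mulnA; set K := d.+1 * D => hX.
(* Distances are at most [n], so a far pair already forces [X] to be large. *)
have Kbig : 4 * K < #|X|.
  rewrite ltnNge; apply/negP => hsmall.
  have : row_dist M x x' * #|X| <= n * (4 * K) by apply: leq_mul.
  rewrite {}/K in hsmall *; nia.
(* Hence [2 * K * q] is at most half of [#|X|], and the packing bound gives [#|X| <= 2 * K],
   contradicting [Kbig]. *)
have : 4 * K * q <= #|X|.
  rewrite -(leq_pmul2l (_ : 0 < n)); last by lia.
  have := leq_mul hq (leqnn #|X|); rewrite {}/K in hX Kbig *; nia.
rewrite mulnA in hX; nia.
Qed.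

Lemma row_dist_perm n (M : 'M[bool]_n) (sr sc : 'S_n) i i' :
  row_dist (\matrix_(i, j) M (sr i) (sc j)) i i' = row_dist M (sr i) (sr i').
Proof.
rewrite /row_dist [RHS](reindex_inj (@perm_inj _ sc)).
by apply: eq_bigr => j _; rewrite !mxE.
Qed.

Lemma twin_width_le_close_rows n d (M : 'M[bool]_n) (X : {set 'I_n}) :
  twin_width_le M d -> 1 < #|X| ->
  exists x x', [/\ x \in X, x' \in X, x != x' &
    row_dist M x x' * #|X| <= 4 * d.+1 ^ 2 * 2 ^ d * n].
Proof.
move=> [sr [sc tw]] X_gt1.
have cardX : #|sr @^-1: X| = #|X|.
  rewrite -(card_imset _ (@perm_inj _ sr)); congr #|pred_of_set _|.
  apply/setP => x; apply/imsetP/idP => [[y]|xX]; first by rewrite inE => + ->.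
  by exists (sr^-1 x)%g; rewrite ?inE permKV.
rewrite -cardX in X_gt1 *.
have [x [x' []]] := twin_ordered_close_rows tw X_gt1.
rewrite row_dist_perm !inE => xX x'X xx' hd; exists (sr x), (sr x'); split=> //.
by rewrite (inj_eq perm_inj).
Qed.

(** * Invariance of twin-width bounds under transposition *)

Lemma nonconst_cell_tr n (M : 'M[bool]_n) (D : division n) a b :
  nonconst_cell M^T (D.2, D.1) a b = nonconst_cell M D b a.
Proof.
apply/existsP/existsP => -[i /existsP[j /existsP[i' /existsP[j']]]].
  rewrite !mxE /= => /and5P[h1 h2 h3 h4 h5]; exists j; apply/existsP; exists i.
  by apply/existsP; exists j'; apply/existsP; exists i'; apply/and5P.
move=> /and5P[h1 h2 h3 h4 h5]; exists j; apply/existsP; exists i.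
apply/existsP; exists j'; apply/existsP; exists i'; rewrite !mxE.
by apply/and5P.
Qed.

Lemma twin_ordered_tr n (M : 'M[bool]_n) d :
  twin_ordered M d -> twin_ordered M^T d.
Proof.
move=> [S [[S0 [Send Sstep]] Swide]]; exists (fun t => ((S t).2, (S t).1)).
split; first split; first by move=> x; have [] := S0 x.
  split=> [x|t /Sstep[h|h]]; first by have [] := Send x.
    by right.
  by left.
move=> t /Swide[w1 w2]; split=> a /=.
  apply: leq_trans (w2 a); apply/subset_leq_card/subsetP => b.
  by rewrite !inE nonconst_cell_tr.
apply: leq_trans (w1 a); apply/subset_leq_card/subsetP => b.
by rewrite !inE nonconst_cell_tr.
Qed.

Lemma twin_width_le_tr n (M : 'M[bool]_n) d :
  twin_width_le M d -> twin_width_le M^T d.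
Proof.
move=> [sr [sc /twin_ordered_tr tw]]; exists sc, sr.
suff <- : (\matrix_(i, j) M (sr i) (sc j))^T%R =
          (\matrix_(i, j) M^T (sc i) (sr j))%R.
  exact: tw.
by apply/matrixP => i j; rewrite !mxE.
Qed.

(** * Orderings built by inserting next to a close point *)

Section NearestInsertion.

Variables (T : finType) (f : T -> T -> nat).
Hypothesis fC : forall x y, f x y = f y x.
Hypothesis f_triangle : forall y x z, f x z <= f x y + f y z.

Lemma consec_sum_cons2 x y (s : seq T) :
  consec_sum f (x :: y :: s) = f x y + consec_sum f (y :: s).
Proof. by rewrite /consec_sum /= big_cons. Qed.

Lemma consec_sum1 x : consec_sum f [:: x] = 0.
Proof. by rewrite /consec_sum /= big_nil. Qed.

Lemma consec_sum_cat x (s1 s2 : seq T) :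
  consec_sum f (s1 ++ x :: s2) = consec_sum f (rcons s1 x) + consec_sum f (x :: s2).
Proof.
elim: s1 => [|y [|z s1] IH] /=; first by rewrite consec_sum1.
  by rewrite !consec_sum_cons2 consec_sum1 addn0.
by rewrite !consec_sum_cons2 -addnA -IH.
Qed.

(** Put [x] right after [y]: the link from [y] to its successor [z] becomes a detour through [x],
    and [f x z] exceeds [f y z] by at most [f x y]. *)
Lemma consec_sum_insert x y (s : seq T) : y \in s ->
  exists2 s', perm_eq s' (x :: s) & consec_sum f s' <= consec_sum f s + 2 * f x y.
Proof.
case/splitPr=> s1 s2; exists (s1 ++ y :: x :: s2).
  rewrite -!(cat_rcons y); exact: (permEl (perm_catCA (rcons s1 y) [:: x] s2)).
rewrite !consec_sum_cat -addnA leq_add2l consec_sum_cons2.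
case: s2 => [|z s2]; rewrite ?consec_sum_cons2 ?consec_sum1 (fC y x); first by lia.
have := f_triangle y x z; lia.
Qed.

Lemma close_pairs_ordering A :
  (forall X : {set T}, 1 < #|X| -> exists x x',
     [/\ x \in X, x' \in X, x != x' & f x x' * #|X| <= A]) ->
  forall X : {set T}, exists2 s, perm_eq s (enum X) &
    consec_sum f s <= 2 * \sum_(2 <= k < #|X|.+1) A %/ k.
Proof.
move=> closeA X; have [m] := ubnP #|X|; elim: m X => // m IH X ltXm.
have [X_le1|X_gt1] := leqP #|X| 1.
  exists (enum X) => //; move: X_le1; rewrite cardE.
  by case: (enum X) => [|x []]; rewrite // ?consec_sum1 // /consec_sum big_nil.
have [x [y [xX yX xy close]]] := closeA X X_gt1.
have cX : #|X| = #|X :\ x|.+1 by rewrite (cardsD1 x) xX.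
have [|s permS leS] := IH (X :\ x); first by rewrite cX in ltXm.
have ys : y \in s by rewrite (perm_mem permS) mem_enum !inE eq_sym xy.
have [s' permS' leS'] := consec_sum_insert x ys; exists s'.
  apply: (perm_trans permS'); apply: uniq_perm; rewrite ?enum_uniq //=.
    by rewrite (perm_uniq permS) (perm_mem permS) mem_enum !inE eqxx enum_uniq.
  move=> z; rewrite inE (perm_mem permS) !mem_enum !inE.
  by have [->|] := eqVneq z x; rewrite ?xX.
have le_fxy : f x y <= A %/ #|X| by rewrite leq_divRL // ltnW.
rewrite big_nat_recr //= mulnDr; apply: leq_trans leS' _.
apply: leq_add; last by rewrite leq_mul2l.
by rewrite [in X in _ <= X]cX.
Qed.

End NearestInsertion.

(** * Logarithmic bound on the harmonic sum *)

Lemma sum_divn_le A j : \sum_(2 <= k < 2 ^ j.+1) A %/ k <= A * j.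
Proof.
elim: j => [|j IH]; first by rewrite big_geq.
rewrite (big_cat_nat (n := 2 ^ j.+1)) /=; last 2 first.
- exact: (@leq_pexp2l 2 1).
- by rewrite leq_exp2l.
rewrite mulnS addnC; apply: leq_add IH.
(* The dyadic block has [2 ^ j.+1] terms, each at most [A %/ 2 ^ j.+1], so it contributes at most
   [A]. *)
apply: (@leq_trans (\sum_(2 ^ j.+1 <= k < 2 ^ j.+2) A %/ 2 ^ j.+1)).
  rewrite !big_nat; apply: leq_sum => k /andP[h _].
  by apply: leq_div2l; rewrite ?expn_gt0.
rewrite sum_nat_const_nat [2 ^ j.+2]expnS mul2n -addnn addnK mulnC.
exact: leq_divM.
Qed.

Lemma harmonic_trunc_log A m :
  \sum_(2 <= k < m.+1) A %/ k <= A * trunc_log 2 m.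
Proof.
case: m => [|m]; first by rewrite big_geq.
apply: leq_trans (sum_divn_le A _).
have h : m.+1 < 2 ^ (trunc_log 2 m.+1).+1 by apply: trunc_log_ltn.
by rewrite [X in _ <= X](big_cat_nat (n := m.+2)) //= leq_addr.
Qed.

(** * Coherence bounds *)

Lemma row_coherence_le n (M : 'M[bool]_n) (pi : 'S_n) :
  row_coherence M <= row_hsum M pi.
Proof.
rewrite /row_coherence; have: pi \in index_enum 'S_n by apply: mem_index_enum.
elim: (index_enum _) => // a r IH; rewrite inE big_cons => /orP[/eqP <-|/IH h].
  exact: geq_minl.
by apply: leq_trans h; apply: geq_minr.
Qed.

Lemma row_coherence_le_seq n (M : 'M[bool]_n) (s : seq 'I_n) :
  perm_eq s (enum 'I_n) -> row_coherence M <= consec_sum (row_dist M) s.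
Proof.
move=> permS; have szS : size s == n by rewrite (perm_size permS) size_enum_ord.
have uniqS : uniq s by rewrite (perm_uniq permS) enum_uniq.
have tinj : injective (tnth (Tuple szS)) by apply/tuple_uniqP.
apply: leq_trans (row_coherence_le M (perm tinj)) _.
rewrite /row_hsum (eq_map (permE tinj)).
by have := map_tnth_enum (Tuple szS) => /= ->.
Qed.

Lemma row_dist_sym n (M : 'M[bool]_n) x y : row_dist M x y = row_dist M y x.
Proof. by apply: eq_bigr => j _; rewrite eq_sym. Qed.

Lemma row_dist_triangle n (M : 'M[bool]_n) y x z :
  row_dist M x z <= row_dist M x y + row_dist M y z.
Proof.
rewrite /row_dist -big_split /=; apply: leq_sum => j _.
by case: (M x j) (M y j) (M z j) => [] [] [].
Qed.

Lemma row_coherence_twin_width_le n d (M : 'M[bool]_n) :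
  twin_width_le M d ->
  row_coherence M <= 8 * d.+1 ^ 2 * 2 ^ d * (n * trunc_log 2 n).
Proof.
move=> tw.
have [s permS leS] := close_pairs_ordering (@row_dist_sym _ M)
  (@row_dist_triangle _ M) (fun X => @twin_width_le_close_rows _ d M X tw) setT.
have {}permS : perm_eq s (enum 'I_n).
  by apply: perm_trans permS _; rewrite (eq_enum (@in_setT _)).
apply: leq_trans (row_coherence_le_seq M permS) _; apply: leq_trans leS _.
rewrite cardsT card_ord.
apply: leq_trans (leq_mul (leqnn 2) (harmonic_trunc_log _ _)) _.
by rewrite !mulnA.
Qed.

(** The packing factor is singly exponential: [d.+1 <= 2 ^ d.+1] bounds it by [2 ^ (3 * d.+1 + 3)],
    and the exponent is at most [8 ^ d.+1]. *)
Lemma twin_width_factor_le d : 8 * d.+1 ^ 2 * 2 ^ d <= 2 ^ (2 ^ (3 * d.+1)).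
Proof.
have hd : d.+1 < 2 ^ d.+1 by apply: ltn_expl.
apply: (@leq_trans (2 ^ (3 * d.+1 + 3))).
  have : d.+1 ^ 2 <= (2 ^ d.+1) ^ 2 by rewrite leq_exp2r // ltnW.
  have : 2 ^ d <= 2 ^ d.+1 by rewrite leq_exp2l.
  rewrite expnD mulnC mulnCA => h1 h2; rewrite [X in _ <= X]mulnC.
  rewrite leq_mul2l /= mulnC [3 * _]mulnC expnM expnS mulnC.
  exact: leq_mul.
rewrite leq_exp2l // -mulnSr expnM -[2 ^ 3]/8.
have : 2 ^ d.+1 <= 4 ^ d.+1 by rewrite leq_exp2r.
rewrite (_ : 8 = 2 * 4) // expnMn; have : 4 <= 4 ^ d.+1.
  exact: (@leq_pexp2l 4 1).
nia.
Qed.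

Theorem theorem3 :
  exists C : nat, forall (n d : nat) (M : 'M[bool]_n),
    twin_width M d ->
    row_coherence M <= 2 ^ (2 ^ (C * d.+1)) * (n * trunc_log 2 n) /\
    col_coherence M <= 2 ^ (2 ^ (C * d.+1)) * (n * trunc_log 2 n).
Proof.
(* The constant 3 comes from [twin_width_factor_le]; columns are handled as rows of the
   transpose. *)
exists 3 => n d M [tw _]; split.
  apply: leq_trans (row_coherence_twin_width_le tw) _.
  exact: leq_mul (twin_width_factor_le d) (leqnn _).
apply: leq_trans (row_coherence_twin_width_le (twin_width_le_tr tw)) _.
exact: leq_mul (twin_width_factor_le d) (leqnn _).
Qed.
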